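(* Let $n\ge1$, let $q_k$ ($k=1,\dots,n$) be real valued locally integrable functions on $[t_0;+\infty)$, let $\alpha_k$ ($k=1,\dots,n$) be real valued locally bounded functions on $[t_0;+\infty)$, and let $p$ be a positive function on $[t_0;+\infty)$ with $1/p$ locally integrable on $[t_0;+\infty)$. Suppose that $q_k(t)\ge0$ for $t\ge t_0$ and $\lim_{t\to+\infty}\alpha_k(t)=+\infty$ for $k=1,\dots,n$, that $$\int_{t_0}^{+\infty}\frac{d\tau}{p(\tau)}=+\infty,$$ and that $$\int_{t_0}^{+\infty}\Bigl(\sum_{k=1}^n q_k(\tau)\Bigr)d\tau=+\infty.$$ Then the equation $$(p(t)\phi'(t))'+\sum_{k=1}^n q_k(t)\phi(\alpha_k(t))=0,\qquad t\ge t_0,$$ is oscillatory.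
   Context: Let $T_0=\min\{t_0,\ \inf_{t\ge t_0,\,1\le k\le n}\alpha_k(t)\}$. A solution of $(p\phi')'+\sum_k q_k(t)\phi(\alpha_k(t))=0$, $t\ge t_0$, is a real valued continuous function $\phi$ on $[T_0;+\infty)$ that is locally absolutely continuous on $[t_0;+\infty)$, such that $p\phi'$ is (after modification on a null set) locally absolutely continuous on $[t_0;+\infty)$, and such that the equation holds almost everywhere on $[t_0;+\infty)$. The equation is called oscillatory if each of its solutions has arbitrarily large zeros. *)

(* Defs.v *)
From HB Require Import structures.
From mathcomp Require Import all_boot all_order all_algebra.
From mathcomp Require Import all_classical all_reals all_analysis.

Set Implicit Arguments.
Unset Strict Implicit.
Unset Printing Implicit Defensive.

Import Order.TTheory GRing.Theory Num.Theory.
Import numFieldNormedType.Exports.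

Local Open Scope classical_set_scope.
Local Open Scope ring_scope.

(* The completed measure is used so that "measurable", "integrable" and
   "almost everywhere" refer to the Lebesgue sigma-algebra;
   [lebesgue_measure] only lives on the Borel sets. *)
Notation leb R := (@completed_lebesgue_measure R).

(* The library's [locally_integrable] requires an open domain, which excludes
   half-lines of the form [t0, +oo[. *)
Definition loc_integrable (R : realType) (D : set R) (f : R -> R) : Prop :=
  forall K : set R, compact K -> K `<=` D ->
    (leb R).-integrable K (EFin \o f).

Definition loc_bounded (R : realType) (D : set R) (f : R -> R) : Prop :=
  forall K : set R, compact K -> K `<=` D -> [bounded f x | x in K].

Definition abs_continuous (R : realType) (a b : R) (f : R -> R) : Prop :=
  forall e : R, 0 < e -> exists2 d : R, 0 < d &
    forall (m : nat) (x y : 'I_m -> R),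
      (forall i, [/\ a <= x i, x i <= y i & y i <= b]) ->
      trivIset setT (fun i => `]x i, y i[%classic) ->
      \sum_(i < m) (y i - x i) < d ->
      \sum_(i < m) `|f (y i) - f (x i)| < e.

Definition loc_abs_continuous (R : realType) (D : set R) (f : R -> R) : Prop :=
  forall a b : R, `[a, b] `<=` D -> abs_continuous a b f.

(* [inf] is the true infimum only for nonempty sets bounded below; this is the
   case when 0 < n and the [alpha k] are locally bounded and tend to +oo. *)
Definition initial_point (R : realType) (n : nat) (t0 : R)
    (alpha : 'I_n -> R -> R) : R :=
  Num.min t0 (inf [set s | exists k, exists2 t, t0 <= t & s = alpha k t]).

(* Functions on half-lines are total functions whose values outside the
   half-line are irrelevant.  [psi] is the locally absolutely continuous
   modification of [p * phi'].  As [^`()] is total, derivability is demanded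
   explicitly; the one-sided point t0 is absorbed by the null set. *)
Definition is_solution (R : realType) (n : nat) (t0 : R) (p : R -> R)
    (q alpha : 'I_n -> R -> R) (phi : R -> R) : Prop :=
  [/\ {within `[initial_point t0 alpha, +oo[, continuous phi},
      loc_abs_continuous `[t0, +oo[ phi &
      exists psi : R -> R,
        [/\ loc_abs_continuous `[t0, +oo[ psi,
            {ae leb R, forall t : R, t0 <= t ->
               derivable phi t 1 /\ psi t = p t * phi^`()%classic t} &
            {ae leb R, forall t : R, t0 <= t ->
               derivable psi t 1 /\
               psi^`()%classic t + \sum_(k < n) q k t * phi (alpha k t) = 0}]].

Definition oscillatory (R : realType) (n : nat) (t0 : R) (p : R -> R)
    (q alpha : 'I_n -> R -> R) : Prop :=
  forall phi : R -> R, is_solution t0 p q alpha phi ->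
    forall T : R, exists2 t : R, T <= t & phi t = 0.

(* Main.v *)
Require Import Defs.
From HB Require Import structures.
From mathcomp Require Import all_boot all_order all_algebra.
From mathcomp Require Import all_classical all_reals all_analysis.
From mathcomp Require Import measurable_realfun lra.

Set Implicit Arguments.
Unset Strict Implicit.
Unset Printing Implicit Defensive.

Import Order.TTheory GRing.Theory Num.Theory.
Import numFieldNormedType.Exports.

Local Open Scope classical_set_scope.
Local Open Scope ring_scope.

(** Why the theorem is true.  A solution without large zeros has, by
    continuity, a constant sign from some point on, and changing its sign if
    necessary it is eventually positive.  Let psi be the locally absolutely
    continuous version of p phi'.  Once every alpha_k(t) lies where phi is
    positive, psi' = - sum_k q_k phi(alpha_k) <= 0, so psi is nonincreasing.

    First, psi >= 0 there: if psi(s) < 0, then (- phi)' >= (- psi(s)) / p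
    beyond s, and the divergence of the integral of 1/p makes - phi unbounded
    above, against the positivity of phi.  Hence phi' >= 0 and phi is
    nondecreasing, so that phi(alpha_k(t)) is eventually bounded below by a
    constant c > 0.  Then (- psi)' >= c sum_k q_k, and the divergence of the
    integral of sum_k q_k makes - psi unbounded above, against psi >= 0.
    This argument is [solution_not_eventually_pos].

    Both contradictions rest on [loc_abs_continuous_unbounded]: a locally
    absolutely continuous F with F' >= c g almost everywhere, where c > 0 and
    g >= 0 has a divergent integral, is unbounded above.  Of the two halves of
    the fundamental theorem of calculus for the Lebesgue integral, its proof
    uses one-sided versions that have direct proofs.

    The first is [abs_continuous_nondecreasing]: an absolutely continuous
    function with nonnegative derivative almost everywhere is nondecreasing.
    It is obtained by moving from left to right through the interval: near a
    point where the derivative exists and is nonnegative, the function loses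
    at most epsilon times the distance covered; the exceptional points lie in
    an open set of small measure, and absolute continuity bounds the total
    loss over the steps made inside that set.

    The second is [integral_le_increment]: for a nondecreasing F, the
    integral of any 0 <= g <= F' is at most the increment of F.  This is
    Fatou's lemma applied to the difference quotients of F over ever finer
    equal subdivisions, step functions whose integrals telescope. *)

(** * Absolutely continuous functions with nonnegative derivative *)

(** The step at the supremum s of the points of [a, b] where P holds carries P
    from a point just before s to a point beyond s, unless s = b.  The step is
    asked only for s between u and v, which is what differentiability at s, or
    membership of s in an open set, provides. *)
Lemma real_induction (R : realType) (P : R -> Prop) (a b : R) :
  a <= b -> P a ->
  (forall s, a <= s -> s <= b -> exists2 d, 0 < d &
     forall u v, a <= u -> s - d < u -> u <= s -> s <= v -> v < s + d ->
       v <= b -> P u -> P v) ->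
  P b.
Proof.
move=> ab Pa step; pose S := [set t | [/\ a <= t, t <= b & P t]].
have supS : has_sup S.
  by split; [exists a; split|exists b => t [_ + _]].
have as_ : a <= sup S by apply: ub_le_sup; [exact: supS.2|split].
have sb : sup S <= b by apply: ge_sup; [exact: supS.1|move=> t []].
have [d d0 stepd] := step _ as_ sb.
have [u [au ub Pu] du] := sup_adherent d0 supS.
have us : u <= sup S by apply: ub_le_sup; [exact: supS.2|split].
pose v := Num.min b (sup S + d / 2).
have sv : sup S <= v by rewrite le_min sb lerDl divr_ge0 // ltW.
have vd : v < sup S + d by rewrite gt_min; apply/orP; right; lra.
have vb : v <= b by rewrite ge_min lexx.
have Pv : P v by exact: (stepd u).
have vs : v <= sup S.
  by apply: ub_le_sup; [exact: supS.2|split=> //; lra].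
move: vs; rewrite {1}/v ge_min => /orP[bs|]; last by move=> ?; lra.
suff <- : v = b by [].
by apply/eqP; rewrite eq_le vb; lra.
Qed.

(** Differentiability at s controls increments between two points only when
    they lie on either side of s: the slope over [u, v] is then a convex
    combination of the slopes over [u, s] and [s, v]. *)
Lemma straddle (R : realType) (f : R -> R) (s c : R) :
  derivable f s 1 -> c < f^`()%classic s ->
  exists2 d, 0 < d & forall u v, s - d < u -> u <= s -> s <= v -> v < s + d ->
    c * (v - u) <= f v - f u.
Proof.
move=> fs cf.
have : (fun h => h^-1 *: (f (h + s) - f s)) @ 0^' --> f^`()%classic s.
  rewrite derive1E /derive.
  rewrite (_ : (fun h : R => h^-1 *: (f (h + s) - f s)) =
    (fun h => h^-1 *: ((f \o shift s) (h *: 1) - f s))); last first.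
    by apply/funext => h /=; rewrite /GRing.scale /= mulr1.
  exact: fs.
move=> /(@cvgr_gt _ _ _ _ _) /(_ _ cf).
rewrite near_withinE => /nbhs_ballP[d /= d0 H].
have H' (h : R) : `|h| < d -> h != 0 -> c < h^-1 * (f (h + s) - f s).
  by move=> hd h0; apply: H => //; rewrite /ball /= sub0r normrN.
exists d => // u v du us sv vd.
have up : c * (v - s) <= f v - f s.
  have [->|vs] := eqVneq v s; first by rewrite !subrr mulr0.
  have vs0 : 0 < v - s by rewrite subr_gt0 lt_neqAle eq_sym vs.
  have := H' (v - s); rewrite gtr0_norm // subrK gt_eqF // => /(_ _ isT).
  rewrite mulrC ltr_pdivlMr // => hh; apply/ltW/hh; lra.
have low : c * (s - u) <= f s - f u.
  have [->|us'] := eqVneq s u; first by rewrite !subrr mulr0.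
  have us0 : u - s < 0 by rewrite subr_lt0 lt_neqAle eq_sym us'.
  have := H' (u - s); rewrite ltr0_norm // subrK lt_eqF // => /(_ _ isT).
  rewrite mulrC ltr_ndivlMr // => hh.
  have /hh : - (u - s) < d by lra.
  lra.
lra.
Qed.

(** The completed measure and the Borel one are restrictions of the same outer
    measure, whose outer regularity holds for arbitrary sets. *)
Lemma negligible_open_cover (R : realType) (N : set R) (e : R) : 0 < e ->
  (leb R).-negligible N ->
  exists U : set R, [/\ open U, N `<=` U & (lebesgue_measure U <= e%:E)%E].
Proof.
move=> e0 [A [mA A0 NA]].
have [U [oU AU Ue]] := outer_measure_open_le A e0.
exists U; split => //; first exact: subset_trans AU.
by move: Ue; rewrite [X in (_ <= X + _)%E -> _](_ : _ = 0%E) ?add0e.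
Qed.

Lemma sum_itv_le (R : realType) (U : set R) (m : nat) (x y : 'I_m -> R) :
  measurable (U : set (measurableTypeR R)) ->
  (forall i, x i <= y i) ->
  trivIset setT (fun i => `]x i, y i[%classic) ->
  (forall i, `]x i, y i[ `<=` U) ->
  ((\sum_(i < m) (y i - x i))%:E <= lebesgue_measure U)%E.
Proof.
move=> mU xy tI sU.
have -> : (\sum_(i < m) (y i - x i))%:E =
  (\sum_(i < m) lebesgue_measure (`]x i, y i[%classic : set R))%E.
  rewrite -sumEFin; apply: eq_bigr => i _.
  rewrite lebesgue_measure_itv /= lte_fin; case: ltP => // yx.
  by rewrite (@le_anti _ _ (x i) (y i)) ?subrr // xy yx.
rewrite -measure_bigsetU_ord //; apply: le_measure; rewrite ?inE //.
- exact: bigsetU_measurable.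
- by apply: (@big_ind _ (fun A => A `<=` U)) => // A B AU BU t [/AU|/BU].
Qed.

(** The induction predicate at t keeps a record of the steps made so far across
    exceptional points, as disjoint intervals inside the small open set U: the
    loss f a - f t is then at most epsilon (t - a), from the steps around good
    points, plus the variation of f over the recorded intervals. *)
Lemma abs_continuous_nondecreasing (R : realType) (f : R -> R) (a b : R) :
  a <= b -> abs_continuous a b f ->
  {ae leb R, forall t, a <= t <= b -> derivable f t 1 /\ 0 <= f^`()%classic t} ->
  f a <= f b.
Proof.
move=> ab ACf aef.
suff H e : 0 < e -> f a <= f b + e * (b - a) + e.
  apply/ler_addgt0Pr => e e0.
  have k0 : 0 < b - a + 1 by lra.
  have := H (e / (b - a + 1)) (divr_gt0 e0 k0).
  set e' := e / _ => He.
  suff : e' * (b - a) + e' = e by lra.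
  by rewrite -[X in _ + X]mulr1 -mulrDr divfK // gt_eqF.
move=> e0; have [d d0 Hd] := ACf _ e0.
have d20 : 0 < d / 2 by rewrite divr_gt0.
have [U [oU NU Ud]] := negligible_open_cover d20 aef.
pose P t := exists m (x y : 'I_m -> R),
  [/\ forall i, [/\ a <= x i, x i <= y i & y i <= t],
      trivIset setT (fun i => `]x i, y i[%classic),
      forall i, `]x i, y i[ `<=` U &
      f a - f t <= e * (t - a) + \sum_(i < m) `|f (y i) - f (x i)|].
suff [m [x [y [xy tI sU]]]] : P b.
  have : \sum_(i < m) `|f (y i) - f (x i)| < e.
    apply: Hd => //; rewrite -lte_fin.
    apply: (@le_lt_trans _ _ (d / 2)%:E); last by rewrite lte_fin; lra.
    apply: le_trans Ud; apply: sum_itv_le => //; first exact: open_measurable.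
    by move=> i; have [] := xy i.
  lra.
apply: (@real_induction _ P a b) => //.
  exists 0, (fun=> a), (fun=> a); split=> [[]//||[]//|].
    by apply/trivIsetP => -[].
  by rewrite !subrr mulr0 big_ord0 addr0.
move=> s as_ sb.
(* The slack - e makes the lower bound on the slope at s strict, as straddle
   requires when the derivative vanishes. *)
have [good|bad] := pselect (derivable f s 1 /\ 0 <= f^`()%classic s).
  have [|r r0 Hr] := @straddle _ f s (- e) good.1; first by lra.
  exists r => // u v au ru us sv vr vb [m [x [y [xy tI sU fu]]]].
  exists m, x, y; split => //.
    move=> i; have [? ? ?] := xy i; split => //; lra.
  have := Hr u v ru us sv vr; lra.
have Us : U s by apply: NU => /=; apply: contra_not bad; apply; rewrite as_.
have [r /= r0 Hr] : exists2 r, 0 < r & ball s r `<=` U.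
  by apply/nbhs_ballP; apply: open_nbhs_nbhs.
exists r => // u v au ru us sv vr vb [m [x [y [xy tI sU fu]]]].
(* Appends c at the last index to a family z. *)
pose ext (z : 'I_m -> R) c (i : 'I_m.+1) :=
  if unlift ord_max i is Some j then z j else c.
have extm z c : ext z c ord_max = c by rewrite /ext unlift_none.
have extl z c j : ext z c (widen_ord (leqnSn m) j) = z j.
  rewrite /ext (_ : widen_ord _ j = lift ord_max j) ?liftK //.
  by apply/val_inj; rewrite /= /bump leqNgt ltn_ord.
have ordP (i : 'I_m.+1) : i = ord_max \/ exists j, i = widen_ord (leqnSn m) j.
  case: (unliftP ord_max i) => [j ->|->]; [right; exists j|by left].
  by apply/val_inj; rewrite /= /bump leqNgt ltn_ord.
exists m.+1, (ext x u), (ext y v); split.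
- move=> i; have [->|[j ->]] := ordP i; rewrite ?extm ?extl.
    by split => //; lra.
  have [? ? ?] := xy j; split => //; lra.
- apply/trivIsetP => i j _ _ ij; apply/seteqP; split => // t [].
  move: ij; have [->|[i' ->]] := ordP i; have [->|[j' ->]] := ordP j;
    rewrite ?extm ?extl ?eqxx //=.
  + by have [_ _ ?] := xy j'; rewrite !in_itv /= => _ /andP[? ?] /andP[? ?]; lra.
  + by have [_ _ ?] := xy i'; rewrite !in_itv /= => _ /andP[? ?] /andP[? ?]; lra.
  + move=> ij ti tj; have ij' : i' != j' by apply: contra_neq ij => ->.
    have : (`]x i', y i'[ `&` `]x j', y j'[) t by split.
    by rewrite (trivIsetP.1 tI i' j' I I ij').
- move=> i; have [->|[j ->]] := ordP i; rewrite ?extm ?extl //.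
  move=> t; rewrite /= in_itv /= => /andP[ut tv]; apply: Hr.
  rewrite /ball /= ltr_norml; lra.
- rewrite big_ord_recr /= !extm; under eq_bigr do rewrite !extl.
  have : f u - f v <= `|f v - f u| by rewrite distrC ler_norm.
  have : 0 <= e * (v - u) by rewrite mulr_ge0 //; lra.
  move: fu; lra.
Qed.

(** * Integrals below the increments of monotone functions *)

(** The real line with its Lebesgue sigma-algebra; [R] itself only carries the
    Borel one. *)
Notation completedR R :=
  (caratheodory_type (@wlength R idfun)^*%mu).

Lemma completed_measurable_itv (R : realType) (i : interval R) :
  measurable ([set` i] : set (completedR R)).
Proof. by apply: sub_caratheodory; exact: measurable_itv. Qed.

Lemma completed_lebesgue_measure_itv (R : realType) (i : interval R) :
  leb R [set` i] = (if i.1 < i.2 then (i.2 : \bar R) - i.1 else 0)%E.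
Proof. exact: lebesgue_measure_itv. Qed.

(** [filterS] with the carrier fixed: the filter structure of the almost
    everywhere quantifier is attached to [completedR R], whereas the predicates
    at hand are over [R]. *)
Lemma ae_mono (R : realType) (P Q : R -> Prop) :
  (forall t, P t -> Q t) -> {ae leb R, forall t, P t} ->
  {ae leb R, forall t, Q t}.
Proof.
move=> PQ; apply: (@negligibleS _ (completedR R) R (leb R)).
by move=> t; apply: contra_not; exact: PQ.
Qed.

(** Fatou's lemma, in the form where f is known to be almost everywhere below
    the inferior limit of the G n. *)
Lemma integral_le_of_eventual_minorant d (T : measurableType d) (R : realType)
    (mu : {measure set T -> \bar R}) (D : set T) (f : T -> \bar R)
    (G : (T -> \bar R)^nat) (M : \bar R) :
  measurable D -> measurable_fun D f -> (forall x, D x -> (0 <= f x)%E) ->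
  (forall n, measurable_fun D (G n)) ->
  (forall n x, D x -> (0 <= G n x)%E) ->
  {ae mu, forall x, D x -> forall e : R, 0 < e ->
     \forall n \near \oo, (f x - e%:E <= G n x)%E} ->
  (forall n, (\int[mu]_(x in D) G n x <= M)%E) ->
  (\int[mu]_(x in D) f x <= M)%E.
Proof.
move=> mD mf f0 mG G0 fG GM.
have limE (u : (\bar R)^nat) : limn_einf u = ereal_sup (range (einfs u)).
  by rewrite limn_einf_lim; apply/cvg_lim => //; exact: cvg_einfs_sup.
apply: (@le_trans _ _ (\int[mu]_(x in D) limn_einf (G ^~ x))%E); last first.
  apply: (le_trans (fatou mu mD mG G0)); rewrite limE.
  apply: ge_ereal_sup => _ [n _ <-]; apply: le_trans (GM n).
  by apply: ereal_inf_lbound; exists n => //=.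
apply: ae_ge0_le_integral => //.
- move=> x Dx; rewrite limE; apply: (@le_trans _ _ (einfs (G ^~ x) 0%N)).
    by apply: le_ereal_inf_tmp => _ [n /= _ <-]; exact: G0.
  by apply: ereal_sup_ubound; exists 0%N.
- apply: (@measurableT_comp _ _ _ _ _ _ -%E%E) => //.
  apply: (@measurable_fun_limn_esup _ _ _ _ (fun n x => - G n x)%E) => n.
  exact: measurableT_comp.
- apply: filterS fG => x H Dx; apply/lee_subgt0Pr => e e0.
  have [N _ NH] := H Dx e e0; rewrite limE.
  apply: (@le_trans _ _ (einfs (G ^~ x) N)).
    by apply: le_ereal_inf_tmp => _ [n /= Nn <-]; exact: NH.
  by apply: ereal_sup_ubound; exists N.
Qed.

(** On a cell of the n-th subdivision G n is the slope of F over that cell.  At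
    a point of differentiability these slopes are eventually above g x - e by
    [straddle], while the integral of G n telescopes to F b - F a. *)
Lemma integral_le_increment (R : realType) (F g : R -> R) (a b : R) :
  a < b ->
  (forall u v, a <= u -> u <= v -> v <= b -> F u <= F v) ->
  measurable_fun (`[a, b[ : set (completedR R)) (EFin \o g) ->
  (forall t, a <= t < b -> 0 <= g t) ->
  {ae leb R, forall t, a <= t < b -> derivable F t 1 /\ g t <= F^`()%classic t} ->
  (\int[leb R]_(t in `[a, b[) (g t)%:E <= (F b - F a)%:E)%E.
Proof.
move=> ab ndF mg g0 aeF.
pose w n : R := (b - a) / n.+1%:R.
have w0 n : 0 < w n by rewrite divr_gt0 // subr_gt0.
pose t n i : R := a + i%:R * w n.
have t0 n : t n 0%N = a by rewrite /t mul0r addr0.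
have tb n : t n n.+1 = b by rewrite /t /w mulrC divfK // addrC subrK.
have tS n i : t n i.+1 - t n i = w n.
  by rewrite /t -natr1 mulrDl mul1r; lra.
have at_ n i : a <= t n i by rewrite lerDl mulr_ge0 // ltW.
have tle n i : (i < n.+1)%N -> t n i.+1 <= b.
  by move=> i_n; rewrite -(tb n) lerD2l ler_wpM2r ?ler_nat // ltW.
pose c n i := (F (t n i.+1) - F (t n i)) / w n.
have c0 n i : (i < n.+1)%N -> 0 <= c n i.
  move=> i_n; apply: divr_ge0; last exact: ltW.
  rewrite subr_ge0; apply: ndF => //; last exact: tle.
  have := tS n i; have := w0 n; lra.
pose I n i : set R := `[t n i, t n i.+1[%classic.
pose G n x : \bar R := (\sum_(i < n.+1) (c n i)%:E * (\1_(I n i) x)%:E)%E.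
have mI n i D : measurable_fun (D : set (completedR R))
    (fun x => (\1_(I n i) x : R)%:E).
  by apply/measurable_EFinP; apply: measurable_indic; exact: completed_measurable_itv.
have mcI n i D : measurable_fun (D : set (completedR R))
    (fun x => (c n i)%:E * (\1_(I n i) x : R)%:E)%E.
  apply: emeasurable_funM => //; exact: measurable_cst.
have cI0 n (i : 'I_n.+1) x : (0 <= (c n i)%:E * (\1_(I n i) x : R)%:E)%E.
  by rewrite mule_ge0 // lee_fin // c0.
have mD := completed_measurable_itv (`[a, b[).
apply: (@integral_le_of_eventual_minorant _ (completedR R) R (leb R)
  `[a, b[%classic (fun t => (g t)%:E) G) => //.
- move=> n; apply: emeasurable_sum => i; exact: mcI.
- by move=> n x _; apply: sume_ge0 => i _.
- apply: ae_mono aeF => x H xab e e0.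
  move: xab; rewrite /= in_itv /= => xab.
  have [Fx gx] := H xab; move/andP: xab => [ax xb].
  have [|r r0 Hr] := @straddle _ F x (g x - e) Fx; first by lra.
  have rw0 : 0 < r / (b - a) by rewrite divr_gt0 // subr_gt0.
  near=> n.
  have wr : w n < r.
    rewrite /w -ltr_pdivlMl ?subr_gt0 // mulrC.
    by near: n; exact: (near_infty_natSinv_lt (PosNum rw0)).
  (* The index of the cell that contains x. *)
  pose k := Num.truncn ((x - a) / w n).
  have /andP[k1 k2] : k%:R <= (x - a) / w n < k.+1%:R.
    by apply: truncn_itv; rewrite divr_ge0 ?subr_ge0 // ltW.
  have tkx : t n k <= x by move: k1; rewrite ler_pdivlMr // /t; lra.
  have xtk : x < t n k.+1 by move: k2; rewrite ltr_pdivrMr // /t; lra.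
  have kn : (k < n.+1)%N.
    rewrite -(ltr_nat R) -(ltr_pM2r (w0 n)) -(ltrD2l a).
    by rewrite -/(t n k) -/(t n n.+1) tb; lra.
  rewrite /G (bigD1 (Ordinal kn)) //= indicE mem_set ?mule1; last first.
    by rewrite /I /= in_itv /= tkx.
  apply: (@le_trans _ _ (c n k)%:E); last by rewrite leeDl // sume_ge0.
  rewrite -EFinB lee_fin /c ler_pdivlMr // -(tS n k).
  have tSk := tS n k; apply: Hr; lra.
- move=> n; rewrite /G ge0_integral_sum //.
  apply: (@le_trans _ _ (\sum_(i < n.+1) (F (t n i.+1) - F (t n i))%:E)%E).
    apply: lee_sum => i _.
    rewrite ge0_integralZl_EFin //; last exact: c0.
    rewrite integral_indic //; last exact: completed_measurable_itv.
    apply: (@le_trans _ _ ((c n i)%:E * (w n)%:E)%E).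
      rewrite lee_wpmul2l ?lee_fin ?c0 //.
      apply: (@le_trans _ _ (leb R (I n i))).
        apply: le_measure; rewrite ?inE //.
        - by apply: measurableI => //; exact: completed_measurable_itv.
        - exact: completed_measurable_itv.
      rewrite completed_lebesgue_measure_itv /= -EFinB tS.
      by case: ifP => // _; rewrite lee_fin ltW.
    by rewrite -EFinM divfK // gt_eqF.
  rewrite sumEFin -(big_mkord xpredT (fun i => F (t n i.+1) - F (t n i))).
  by rewrite telescope_sumr // tb t0.
Unshelve. all: by end_near. Qed.

(** * Divergence of an integral forces unboundedness *)

Lemma loc_abs_continuous_nondecreasing (R : realType) (F : R -> R) (t0 a : R) :
  t0 <= a -> loc_abs_continuous `[t0, +oo[ F ->
  {ae leb R, forall t, a <= t -> derivable F t 1 /\ 0 <= F^`()%classic t} ->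
  forall u v, a <= u -> u <= v -> F u <= F v.
Proof.
move=> t0a acF aeF u v au uv; apply: abs_continuous_nondecreasing => //.
  by apply: acF => t; rewrite /= !in_itv /= andbT => /andP[ut _]; lra.
by apply: ae_mono aeF => t H /andP[ut _]; apply: H; lra.
Qed.

Lemma loc_integrable_itvco (R : realType) (g : R -> R) (t0 u v : R) :
  t0 <= u -> loc_integrable `[t0, +oo[ g ->
  (leb R).-integrable `[u, v[ (EFin \o g).
Proof.
move=> t0u ig.
have iK : (leb R).-integrable `[u, v] (EFin \o g).
  apply: ig; first exact: segment_compact.
  by move=> t; rewrite /= !in_itv /= andbT => /andP[? _]; lra.
apply: integrableS iK; try exact: completed_measurable_itv.
by move=> t; rewrite /= !in_itv /= => /andP[-> /ltW].
Qed.

(** The piece over [t0, a[ is finite by local integrability, so it is the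
    integrals over [a, b[ that diverge; by monotone convergence they would stay
    bounded only if the integral over the whole half-line were finite. *)
Lemma integral_tail_infty (R : realType) (g : R -> R) (t0 a : R) :
  t0 <= a -> loc_integrable `[t0, +oo[ g ->
  (forall t, t0 <= t -> 0 <= g t) ->
  (\int[leb R]_(t in `[t0, +oo[) (g t)%:E = +oo)%E ->
  forall M : R, exists2 b, a < b & (M%:E < \int[leb R]_(t in `[a, b[) (g t)%:E)%E.
Proof.
move=> t0a ig g0 goo M; apply: contrapT => /forall2NP H.
have mg u v : t0 <= u ->
    measurable_fun (`[u, v[ : set (completedR R)) (EFin \o g).
  by move=> t0u; exact: measurable_int (loc_integrable_itvco v t0u ig).
have unionE : `[a, +oo[%classic = \bigcup_n `[a, a + n.+1%:R[%classic.
  apply/seteqP; split => t /=.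
    rewrite in_itv /= andbT => at_; exists (Num.truncn (t - a)) => //=.
    rewrite in_itv /= at_ -ltrBlDl.
    by have /andP[] : (Num.truncn (t - a))%:R <= t - a < (Num.truncn (t - a)).+1%:R
      by apply: truncn_itv; rewrite subr_ge0.
  by case=> n _; rewrite /= !in_itv /= => /andP[->].
have tail : (\int[leb R]_(t in `[a, +oo[) (g t)%:E <= M%:E)%E.
  rewrite unionE.
  have mF i : measurable (`[a, a + i.+1%:R[ : set (completedR R)).
    exact: completed_measurable_itv.
  have ndF : nondecreasing_seq
      (fun n : nat => (`[a, a + n.+1%:R[%classic : set (completedR R))).
    move=> m n mn; rewrite subsetEset => t /=; rewrite !in_itv /= => /andP[-> h] /=.
    by apply: (lt_le_trans h); rewrite lerD2l ler_nat.
  have cv := @ge0_nondecreasing_set_cvg_integral _ (completedR R) R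
    (fun n : nat => `[a, a + n.+1%:R[%classic) (EFin \o g) (leb R) ndF mF.
  have {}cv := cv (fun i => mg _ _ t0a).
  rewrite -(cvg_lim _ (cv _)) //; last first.
    by move=> i x; rewrite /= in_itv /= => /andP[? _]; rewrite lee_fin; apply: g0; lra.
  apply: lime_le.
    apply: cvgP (cv _).
    by move=> i x; rewrite /= in_itv /= => /andP[? _]; rewrite lee_fin; apply: g0; lra.
  apply: nearW => n; have [|/negP] := H (a + n.+1%:R).
    by rewrite ltrDl ltr0n.
  by rewrite -leNgt.
have head : (\int[leb R]_(t in `[t0, a[) (g t)%:E < +oo)%E.
  apply: integrable_lty; first exact: completed_measurable_itv.
  exact: loc_integrable_itvco (lexx _) ig.
have : (\int[leb R]_(t in `[t0, +oo[) (g t)%:E < +oo)%E; last by rewrite goo ltxx.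
have -> : `[t0, +oo[%classic = `[t0, a[%classic `|` `[a, +oo[%classic.
  apply/seteqP; split => t; rewrite /= !in_itv /= !andbT.
    by move=> ->; case: ltP; [left|right].
  by case=> [/andP[]//|]; lra.
rewrite ge0_integral_setU //.
- rewrite lte_add_pinfty //; exact: le_lt_trans tail (ltry _).
- exact: completed_measurable_itv.
- exact: completed_measurable_itv.
- apply/measurable_funU; try exact: completed_measurable_itv.
  split; first exact: mg.
  rewrite unionE; apply/measurable_fun_bigcup => i; last exact: mg.
  exact: completed_measurable_itv.
- move=> t; rewrite /= !in_itv /= andbT => ht; rewrite lee_fin; apply: g0.
  by case: ht => [/andP[]|]; lra.
- apply/disj_setPLR => t; rewrite /= !in_itv /= andbT => /andP[_ h]; lra.
Qed.

(** F is nondecreasing beyond a, so its increments there dominate c times the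
    integrals of g, which exceed any bound. *)
Lemma loc_abs_continuous_unbounded (R : realType) (F g : R -> R) (t0 a c : R) :
  t0 <= a -> 0 < c -> loc_abs_continuous `[t0, +oo[ F ->
  loc_integrable `[t0, +oo[ g -> (forall t, t0 <= t -> 0 <= g t) ->
  (\int[leb R]_(t in `[t0, +oo[) (g t)%:E = +oo)%E ->
  {ae leb R, forall t, a <= t -> derivable F t 1 /\ c * g t <= F^`()%classic t} ->
  forall M, exists2 b, a <= b & M < F b.
Proof.
move=> t0a c0 acF ig g0 goo aeF M.
have ndF : forall u v, a <= u -> u <= v -> F u <= F v.
  apply: loc_abs_continuous_nondecreasing acF _ => //.
  apply: ae_mono aeF => t H at_; have [? cg] := H at_; split => //.
  apply: le_trans cg; apply: mulr_ge0; [exact: ltW|apply: g0; lra].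
have [b ab Mb] := integral_tail_infty t0a ig g0 goo ((M - F a) / c).
have mg : measurable_fun (`[a, b[ : set (completedR R)) (EFin \o g).
  exact: measurable_int (loc_integrable_itvco b t0a ig).
exists b; first exact: ltW.
have gab t : a <= t < b -> 0 <= g t by move=> /andP[? _]; apply: g0; lra.
have : (\int[leb R]_(t in `[a, b[) (c * g t)%:E <= (F b - F a)%:E)%E.
  apply: integral_le_increment => //.
  - by move=> u v au uv _; exact: ndF.
  - apply/measurable_EFinP; apply: measurable_funM; first exact: measurable_cst.
    exact/measurable_EFinP.
  - by move=> t tab; apply: mulr_ge0; [exact: ltW|exact: gab].
  - by apply: ae_mono aeF => t H /andP[at_ _]; exact: H.
under eq_integral do rewrite EFinM.
rewrite (@ge0_integralZl_EFin _ (completedR R) R (leb R) _ _ (EFin \o g)) //;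
  [|exact: completed_measurable_itv|exact: ltW].
move: Mb; rewrite -(@lte_pmul2l _ c%:E) // -EFinM mulrC divfK ?gt_eqF //.
by move=> /lt_le_trans /[apply]; rewrite lte_fin; lra.
Qed.

(** * Solutions of the delay equation *)

Lemma loc_abs_continuousN (R : realType) (D : set R) (f : R -> R) :
  loc_abs_continuous D f -> loc_abs_continuous D (fun t => - f t).
Proof.
move=> acf a b abD e e0; have [d d0 H] := acf a b abD e e0.
exists d => // m x y xy tI sd; under eq_bigr do rewrite -opprD normrN.
exact: H.
Qed.

Lemma derivable_derive1N (R : realType) (f : R -> R) (t : R) :
  derivable f t 1 ->
  derivable (fun s => - f s) t 1 /\
  (fun s => - f s)^`()%classic t = - f^`()%classic t.
Proof.
move=> ft; split; first exact: derivableN.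
by rewrite !derive1E; exact: deriveN.
Qed.

(** The equation is linear, which reduces eventually negative solutions to
    eventually positive ones. *)
Lemma is_solutionN (R : realType) (n : nat) (t0 : R) (p : R -> R)
    (q alpha : 'I_n -> R -> R) (phi : R -> R) :
  is_solution t0 p q alpha phi -> is_solution t0 p q alpha (fun t => - phi t).
Proof.
case=> cphi acphi [psi [acpsi aephi aepsi]]; split.
- by move=> t; apply: cvgN; exact: cphi.
- exact: loc_abs_continuousN.
exists (fun t => - psi t); split; first exact: loc_abs_continuousN.
- apply: ae_mono aephi => t H t0t; have [dphi ->] := H t0t.
  by have [? ->] := derivable_derive1N dphi; rewrite mulrN.
- apply: ae_mono aepsi => t H t0t; have [dpsi E] := H t0t.
  have [? ->] := derivable_derive1N dpsi; split=> //.
  under eq_bigr do rewrite mulrN.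
  by rewrite sumrN -opprD E oppr0.
Qed.

Lemma loc_integrable_sum (R : realType) (n : nat) (D : set R)
    (q : 'I_n -> R -> R) :
  (forall k, loc_integrable D (q k)) ->
  loc_integrable D (fun t => \sum_(k < n) q k t).
Proof.
move=> qi K cK KD.
rewrite (_ : _ \o _ = fun t => (\sum_(k < n) (q k t)%:E)%E); last first.
  by apply/funext => t /=; rewrite sumEFin.
have mK : measurable (K : set (completedR R)).
  by apply: sub_caratheodory; apply: closed_measurable; exact: compact_closed.
by apply: integrable_sum => // k _; exact: qi.
Qed.

Lemma eventually_ge_all (R : realType) (n : nat) (alpha : 'I_n -> R -> R) :
  (forall k, alpha k t @[t --> +oo] --> +oo) ->
  forall A, exists2 B, A <= B & forall t k, B <= t -> A <= alpha k t.
Proof.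
move=> aoo A.
have : \forall t \near +oo, forall k, A <= alpha k t.
  apply: filter_forall => k.
  by have /cvgryPge := aoo k; apply.
case=> B [_ HB]; exists (Num.max A (B + 1)); first by rewrite le_max lexx.
by move=> t k; rewrite ge_max => /andP[_ Bt]; apply: HB; lra.
Qed.

Lemma nonvanishing_pos (R : realType) (f : R -> R) (s : R) :
  {within `[s, +oo[, continuous f} ->
  (forall t, s <= t -> f t <> 0) -> 0 < f s -> forall t, s <= t -> 0 < f t.
Proof.
move=> cf f0 fs t st; rewrite ltNge; apply/negP => ft.
have cst : {within `[s, t], continuous f}.
  apply: continuous_subspaceW cf => u; rewrite /= !in_itv /= andbT.
  by case/andP.
have [|u] := IVT st cst (v := 0).
  by rewrite ge_min le_max ft (ltW fs) !orbT.
by rewrite in_itv /= => /andP[su _]; exact: f0.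
Qed.

(** Eventually psi is nonincreasing when phi is positive; it must then
    be nonnegative because the integral of 1/p diverges, and cannot stay
    nonnegative because the integral of the sum of the q k diverges. *)
Lemma solution_not_eventually_pos (R : realType) (n : nat) (t0 : R) (p : R -> R)
    (q alpha : 'I_n -> R -> R)
    (q_int : forall k, loc_integrable `[t0, +oo[ (q k))
    (p_gt0 : forall t, t0 <= t -> 0 < p t)
    (pV_int : loc_integrable `[t0, +oo[ (fun t => (p t)^-1))
    (q_ge0 : forall k t, t0 <= t -> 0 <= q k t)
    (alpha_oo : forall k, alpha k t @[t --> +oo] --> +oo)
    (int_pV : (\int[leb R]_(t in `[t0, +oo[) ((p t)^-1)%:E = +oo)%E)
    (int_q : (\int[leb R]_(t in `[t0, +oo[) (\sum_(k < n) q k t)%R%:E = +oo)%E)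
    (phi : R -> R) (T : R) :
  is_solution t0 p q alpha phi -> t0 <= T -> ~ (forall t, T <= t -> 0 < phi t).
Proof.
case=> _ acphi [psi [acpsi aephi aepsi]] t0T phi0.
have [T1 TT1 aT1] := eventually_ge_all alpha_oo T.
have t0T1 : t0 <= T1 by lra.
have acNphi := loc_abs_continuousN acphi.
have acNpsi := loc_abs_continuousN acpsi.
have psi_minorant S c : t0 <= S -> 0 <= c ->
    (forall t k, S <= t -> c <= phi (alpha k t)) ->
    {ae leb R, forall t, S <= t -> derivable (fun s => - psi s) t 1 /\
      c * (\sum_(k < n) q k t) <= (fun s => - psi s)^`()%classic t}.
  move=> t0S c0 cphi; apply: ae_mono aepsi => t H St.
  have t0t : t0 <= t by lra.
  have [dpsi E] := H t0t; have [? ->] := derivable_derive1N dpsi; split => //.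
  have -> : - psi^`()%classic t = \sum_(k < n) q k t * phi (alpha k t) by lra.
  rewrite mulr_sumr; apply: ler_sum => k _; rewrite mulrC.
  by apply: ler_wpM2l; [exact: q_ge0|exact: cphi].
have psi_ni u v : T1 <= u -> u <= v -> psi v <= psi u.
  move=> T1u uv; rewrite -lerN2.
  apply: (loc_abs_continuous_nondecreasing t0T1 acNpsi _ T1u uv).
  have phi_ge0 t k : T1 <= t -> 0 <= phi (alpha k t).
    by move=> T1t; apply/ltW/phi0/aT1.
  by apply: ae_mono (psi_minorant T1 0 t0T1 (lexx _) phi_ge0) => t; rewrite mul0r.
have psi_ge0 s : T1 <= s -> 0 <= psi s.
  move=> T1s; rewrite leNgt; apply/negP => psis.
  have t0s : t0 <= s by lra.
  have [|||b sb] := @loc_abs_continuous_unbounded _ (fun t => - phi t)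
    (fun t => (p t)^-1) t0 s (- psi s) t0s _ acNphi pV_int _ int_pV _ 0.
  - by rewrite oppr_gt0.
  - by move=> t t0t; rewrite invr_ge0 ltW // p_gt0.
  - apply: ae_mono aephi => t H st; have t0t : t0 <= t by lra.
    have [dphi E] := H t0t; have [? ->] := derivable_derive1N dphi; split => //.
    rewrite ler_pdivrMr ?p_gt0 // mulNr mulrC -E lerN2.
    exact: psi_ni.
  - by have := phi0 b; lra.
have phi_nd u v : T1 <= u -> u <= v -> phi u <= phi v.
  apply: (loc_abs_continuous_nondecreasing t0T1 acphi).
  apply: ae_mono aephi => t H T1t; have t0t : t0 <= t by lra.
  have [dphi E] := H t0t; split => //.
  by rewrite -(pmulr_rge0 _ (p_gt0 t t0t)) -E psi_ge0.
have [T2 T12 aT2] := eventually_ge_all alpha_oo T1.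
have t0T2 : t0 <= T2 by lra.
have [||b T2b] := @loc_abs_continuous_unbounded _ (fun t => - psi t)
  (fun t => \sum_(k < n) q k t) t0 T2 (phi T1) t0T2 (phi0 _ TT1) acNpsi
  (loc_integrable_sum q_int) _ int_q _ 0.
- by move=> t t0t; apply: sumr_ge0 => k _; exact: q_ge0.
- apply: psi_minorant => //; first exact/ltW/phi0.
  by move=> t k T2t; apply: phi_nd => //; exact: aT2.
- by have := psi_ge0 b; lra.
Qed.

Unset Implicit Arguments.

Theorem theorem2p4 (R : realType) (n : nat) (t0 : R) (p : R -> R)
    (q alpha : 'I_n -> R -> R)
    (n_ge1 : (1 <= n)%N)
    (q_int : forall k, loc_integrable `[t0, +oo[ (q k))
    (alpha_bnd : forall k, loc_bounded `[t0, +oo[ (alpha k))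
    (p_gt0 : forall t, t0 <= t -> 0 < p t)
    (pV_int : loc_integrable `[t0, +oo[ (fun t => (p t)^-1))
    (q_ge0 : forall k t, t0 <= t -> 0 <= q k t)
    (alpha_oo : forall k, alpha k t @[t --> +oo] --> +oo)
    (int_pV : (\int[leb R]_(t in `[t0, +oo[) ((p t)^-1)%:E = +oo)%E)
    (int_q : (\int[leb R]_(t in `[t0, +oo[) (\sum_(k < n) q k t)%R%:E = +oo)%E) :
  oscillatory t0 p q alpha.
Proof.
move=> phi sol T; apply: contrapT => /forall2NP noz.
pose S := Num.max T t0.
have t0S : t0 <= S by rewrite le_max lexx orbT.
have nz t : S <= t -> phi t <> 0.
  by rewrite ge_max => /andP[Tt _]; case: (noz t).
have cphi : {within `[S, +oo[, continuous phi}.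
  case: sol => + _ _; apply: continuous_subspaceW => t.
  rewrite /= !in_itv /= !andbT; apply: le_trans.
  by rewrite ge_min t0S.
have [phiS|phiS|phiS] := ltgtP 0 (phi S).
- apply: (solution_not_eventually_pos q_int p_gt0 pV_int q_ge0 alpha_oo int_pV
    int_q sol t0S).
  exact: nonvanishing_pos.
- apply: (solution_not_eventually_pos q_int p_gt0 pV_int q_ge0 alpha_oo int_pV
    int_q (is_solutionN sol) t0S).
  apply: nonvanishing_pos.
  + by move=> t; apply: cvgN; exact: cphi.
  + by move=> t St /eqP; rewrite oppr_eq0 => /eqP; exact: nz.
  + by rewrite oppr_gt0.
- by case: (nz S (lexx _)).
Qed.
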